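(* Let $\alpha,\beta,\gamma$ be positive integers and $i,j\ge 0$ integers. Let $G\in \mathrm{Char}(\beta,\gamma)$ be the characteristic function of a matrix $\begin{pmatrix}a&b\\ c&d\end{pmatrix}\in \mathrm{U}(\gamma+\beta j)$, and let $F\in \mathrm{Char}(\alpha,\beta)$ be the characteristic function of a matrix $\begin{pmatrix}p&q\\ r&t\end{pmatrix}\in \mathrm{U}(\beta+\alpha i)$. Suppose $$\det\bigl(1_{\beta j}-d\,(1_j\otimes p)\bigr)\ne 0 .$$ Then $G\circ F\in \mathrm{Char}(\alpha,\gamma)$. More generally, the conclusion $G\circ F\in \mathrm{Char}(\alpha,\gamma)$ holds if $$\det\bigl(1_{\beta j}-d\,(1_j\otimes F(S_0))\bigr)\ne 0\qquad\text{for some } S_0\in \mathrm{B}_\alpha .$$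
   Context: $\mathrm{U}(n)$ is the group of unitary $n\times n$ matrices and $1_n$ the unit matrix of order $n$. $\mathrm{B}_n$ is the set of complex $n\times n$ matrices $z$ with Euclidean operator norm $\|z\|<1$, and $\overline{\mathrm{B}}_n$ is the set of those with $\|z\|\le 1$. For an $m\times m$ matrix $S=(s_{\mu\nu})$, $1_j\otimes S$ denotes the $mj\times mj$ block matrix with $m\times m$ blocks, whose $(\mu,\nu)$ block is $s_{\mu\nu}1_j$. Characteristic functions: for positive integers $m,n$ and an integer $j\ge 0$, let $g=\begin{pmatrix}a&b\\ c&d\end{pmatrix}\in \mathrm{U}(n+mj)$, with $a$ of size $n\times n$ and $d$ of size $mj\times mj$. The characteristic function of $g$ is $$\Theta[g;S]=a+b\,(1_j\otimes S)\bigl(1_{mj}-d\,(1_j\otimes S)\bigr)^{-1}c .$$ It is defined for all $S\in \mathrm{B}_m$ and takes values in $\overline{\mathrm{B}}_n$; as a rational function of $S$ the formula is also used at the points $S\in\overline{\mathrm{B}}_m$ where $\det(1_{mj}-d(1_j\otimes S))\ne0$. $\mathrm{Char}(m,n)$ is the set of all functions $S\mapsto \Theta[g;S]$, where $g\in \mathrm{U}(n+mj)$ and $j=0,1,2,\dots$. The composition is $(G\circ F)(S)=G(F(S))$, where $F(S)\in\overline{\mathrm{B}}_\beta$ and $G$ is evaluated by its rational formula. *)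

(* Defs.v *)
From HB Require Import structures.
From mathcomp Require Import all_boot all_order all_algebra.
From mathcomp Require Import complex mxtens.
From mathcomp Require Import all_classical all_reals.

Set Implicit Arguments.
Unset Strict Implicit.
Unset Printing Implicit Defensive.

Import Order.TTheory GRing.Theory Num.Theory.
Local Open Scope ring_scope.
Local Open Scope complex_scope.
Local Open Scope classical_set_scope.

(* The field of complex numbers is R[i], for R : realType. *)

Definition euclid_norm (R : realType) (n : nat) (x : 'cV[R[i]]_n) : R :=
  Num.sqrt (\sum_(k < n) ComplexField.Normc.normc (x k ord0) ^+ 2).

Definition op_norm (R : realType) (n : nat) (z : 'M[R[i]]_n) : R :=
  sup [set euclid_norm (z *m x) | x in [set x : 'cV_n | euclid_norm x <= 1]].

Definition mxball (R : realType) (n : nat) : set 'M[R[i]]_n :=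
  [set z | op_norm z < 1].

(* The (mu, nu) block of [ampl j S] is s_{mu nu} 1_j: [tensmx S T] has blocks
   s_{mu nu} T, so the factors come in the opposite order to "1_j (x) S". *)
Definition ampl (R : realType) (m j : nat) (S : 'M[R[i]]_m) : 'M[R[i]]_(m * j) :=
  tensmx S (1%:M : 'M_j).

Definition char_den (R : realType) (m n j : nat) (g : 'M[R[i]]_(n + m * j))
    (S : 'M[R[i]]_m) : 'M[R[i]]_(m * j) :=
  1%:M - drsubmx g *m ampl j S.

(* The rational formula; only meaningful where [\det (char_den g S) != 0]. *)
Definition char_formula (R : realType) (m n j : nat) (g : 'M[R[i]]_(n + m * j))
    (S : 'M[R[i]]_m) : 'M[R[i]]_n :=
  ulsubmx g + ursubmx g *m ampl j S *m invmx (char_den g S) *m dlsubmx g.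

(* Theta[g; .] as a partial function ([None] means undefined) on the points of
   the closed ball at which the rational formula makes sense. *)
Definition charfun (R : realType) (m n j : nat) (g : 'M[R[i]]_(n + m * j))
    (S : 'M[R[i]]_m) : option 'M[R[i]]_n :=
  if (op_norm S <= 1) && (\det (char_den g S) != 0)
  then Some (char_formula g S) else None.

(* Elements of Char(m, n) are functions on the open ball, so the values of a
   partial function outside it are irrelevant.  [charfun g] is defined on the
   whole open ball for unitary g, so membership forces f to be so as well. *)
Definition Char (R : realType) (m n : nat)
    (f : 'M[R[i]]_m -> option 'M[R[i]]_n) : Prop :=
  exists (j : nat) (g : 'M[R[i]]_(n + m * j)),
    g \is unitarymx /\ forall S, mxball S -> f S = charfun g S.

(* Main.v *)
Require Import Defs.
From HB Require Import structures.
From mathcomp Require Import all_boot all_order all_algebra.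
From mathcomp Require Import complex mxtens.
From mathcomp Require Import all_classical all_reals.

Set Implicit Arguments.
Unset Strict Implicit.
Unset Printing Implicit Defensive.

Import Order.TTheory GRing.Theory Num.Theory.
Local Open Scope ring_scope.
Local Open Scope complex_scope.
Local Open Scope classical_set_scope.
Local Open Scope sesquilinear_scope.

(** Reading [block_mx a b c d] as a system with input x, output v and internal
    state w, the value of its characteristic function is obtained by closing
    the feedback loop through T = S (x) 1_j:

      v = a x + b T w,    w = c x + d T w.

    When G is evaluated at F(S), the operator in the loop of G is
    F(S) (x) 1_j, and this is again the value of such a system, whose four
    blocks are p (x) 1_j, ..., t (x) 1_j and whose loop contains
    S (x) 1_i (x) 1_j, that is S (x) 1_(i j) (lemmas [lft_tens] and
    [tensmx11]).  Eliminating the signals exchanged by the two systems, which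
    are determined by the inputs exactly when 1 - d (p (x) 1_j) is invertible, leaves a single
    system, their Redheffer star product.  It has the composite as its
    characteristic function ([lft_star]), and it is unitary because energy is
    conserved at both nodes of the network ([star_unitary]).

    Two points remain, both settled by the same energy balance and with no
    analysis.  The composite has to be defined on the whole open ball, and the
    hypothesis at a single S0 has to imply the one at p = F(0).  Suppose that
    d (F(S) (x) 1_j) fixes some x <> 0.  Since d is a contraction,
    F(S) (x) 1_j does not decrease the norm of x; the balance for F then reads
    |w| <= |T w| for its state w, and as T is a strict contraction, w = 0.
    Hence r (x) 1_j kills x, and F(S') (x) 1_j takes the same value
    (p (x) 1_j) x for every S'.  So singularity at one point of the ball is
    singularity at all of them ([unit_lft_indep]). *)

(** * Gram matrices and the energy balance of a unitary matrix *)

Section Gram.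
Variable C : numClosedFieldType.

(** Taking several columns at once lets one identity serve both for the norms
    of vectors and for the proof that a star product is unitary. *)
Definition gram m k (x : 'M[C]_(m, k)) : 'M[C]_k := x^t* *m x.

Definition nsq m (x : 'cV[C]_m) : C := \sum_l `|x l ord0| ^+ 2.

Lemma gram_nsq m (x : 'cV[C]_m) : gram x ord0 ord0 = nsq x.
Proof. by rewrite mxE; apply: eq_bigr => l _; rewrite !mxE normCK mulrC. Qed.

Lemma nsq_ge0 m (x : 'cV[C]_m) : 0 <= nsq x.
Proof. by apply: sumr_ge0 => l _; rewrite exprn_ge0. Qed.

Lemma nsq_eq0 m (x : 'cV[C]_m) : (nsq x == 0) = (x == 0).
Proof.
apply/eqP/eqP => [/psumr_eq0P x0|->]; last first.
  by rewrite /nsq big1// => l _; rewrite mxE normr0 expr0n.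
apply/matrixP => l k; rewrite (ord1 k) mxE; apply/eqP.
by rewrite -normr_eq0 -sqrf_eq0; apply/eqP/x0 => // l' _; rewrite exprn_ge0.
Qed.

Lemma nsqZ m (t : C) (x : 'cV[C]_m) : nsq (t *: x) = `|t| ^+ 2 * nsq x.
Proof.
by rewrite mulr_sumr; apply: eq_bigr => l _; rewrite mxE normrM exprMn.
Qed.

Lemma gram_col_mx m1 m2 k (x : 'M[C]_(m1, k)) (y : 'M_(m2, k)) :
  gram (col_mx x y) = gram x + gram y.
Proof. by rewrite /gram tr_col_mx map_row_mx mul_row_col. Qed.

Lemma gram_unitary m k (u : 'M[C]_m) (x : 'M_(m, k)) :
  u \is unitarymx -> gram (u *m x) = gram x.
Proof.
move=> /unitarymxP/mulmx1C uu.
by rewrite /gram trmx_mul map_mxM mulmxA -(mulmxA _ _ u) uu mulmx1.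
Qed.

Lemma unitarymx_gram m (u : 'M[C]_m) : gram u = 1%:M -> u \is unitarymx.
Proof. by move=> /mulmx1C uu; apply/unitarymxP. Qed.

(** Energy conservation: the block matrix maps the stacked input (x, y) to the
    stacked output, and a unitary matrix preserves Gram matrices. *)
Lemma gram_block m1 m2 k (a : 'M[C]_m1) b c (d : 'M_m2)
    (x : 'M_(m1, k)) (y : 'M_(m2, k)) : block_mx a b c d \is unitarymx ->
  gram (a *m x + b *m y) + gram (c *m x + d *m y) = gram x + gram y.
Proof.
by move=> U; rewrite -!gram_col_mx -mul_block_col gram_unitary.
Qed.

Lemma nsq_block m1 m2 (a : 'M[C]_m1) b c (d : 'M_m2) x y :
  block_mx a b c d \is unitarymx ->
  nsq (a *m x + b *m y) + nsq (c *m x + d *m y) = nsq x + nsq y.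
Proof.
move=> U; have := congr1 (fun M : 'M_1 => M ord0 ord0) (gram_block x y U).
by rewrite [LHS]mxE [RHS]mxE !gram_nsq.
Qed.

Definition strict_contraction m (T : 'M[C]_m) : Prop :=
  forall x : 'cV_m, x != 0 -> nsq (T *m x) < nsq x.

Lemma strict_le m (T : 'M[C]_m) x : strict_contraction T -> nsq (T *m x) <= nsq x.
Proof.
move=> sT; have [->|/sT/ltW//] := eqVneq x 0.
by rewrite mulmx0.
Qed.

Lemma strict0 m : strict_contraction (0 : 'M[C]_m).
Proof.
move=> x x0; rewrite mul0mx (eqP (_ : nsq 0 == 0)) ?nsq_eq0//.
by rewrite lt_def nsq_eq0 x0 nsq_ge0.
Qed.

End Gram.

(** * Feedback loops and the star product *)

Section Lft.
Variable K : fieldType.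

(** The lower linear fractional transformation of T, i.e. the system
    closed by the feedback T. *)
Definition lft m1 m2 (a : 'M[K]_m1) b c (d T : 'M_m2) : 'M[K]_m1 :=
  a + b *m T *m invmx (1%:M - d *m T) *m c.

(** Working with the state equation, rather than with the inverse matrix in
    the definition, is what turns the composition of characteristic functions
    into a mere elimination of variables. *)
Lemma lftE m1 m2 k (a : 'M[K]_m1) b c (d T : 'M_m2) (x : 'M_(m1, k)) w :
    1%:M - d *m T \in unitmx -> w = c *m x + d *m (T *m w) ->
  lft a b c d T *m x = a *m x + b *m (T *m w).
Proof.
move=> U /eqP; rewrite -subr_eq => /eqP Ew.
rewrite /lft mulmxDl -!mulmxA -Ew; congr (_ + _ *m (_ *m _)).
by rewrite (mulmxA d) -{1}(mul1mx w) -mulmxBl mulKmx.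
Qed.

Lemma lft_state m1 m2 k (c : 'M[K]_(m2, m1)) (d T : 'M_m2) (x : 'M_(m1, k)) :
  1%:M - d *m T \in unitmx -> exists w, w = c *m x + d *m (T *m w).
Proof.
move=> U; exists (invmx (1%:M - d *m T) *m (c *m x)).
rewrite [d *m (T *m _)]mulmxA; apply/eqP; rewrite -subr_eq.
by rewrite -{1}(mul1mx (invmx _ *m _)) -mulmxBl mulKVmx.
Qed.

Lemma non_unit_fixed m (M : 'M[K]_m) : 1%:M - M \notin unitmx ->
  exists2 x : 'cV_m, x != 0 & M *m x = x.
Proof.
rewrite -unitmx_tr unitmxE unitfE negbK => /det0P[v v0 E].
exists v^T; first by rewrite trmx_eq0.
move/(congr1 trmx): E; rewrite trmx_mul trmxK mulmxBl mul1mx trmx0.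
by move/eqP; rewrite subr_eq0 => /eqP.
Qed.

Lemma fixed_non_unit m (M : 'M[K]_m) (x : 'cV_m) : x != 0 -> M *m x = x ->
  1%:M - M \notin unitmx.
Proof.
move=> x0 Mx; apply: contra x0 => U.
by rewrite -(mulKmx U x) mulmxBl mul1mx Mx subrr mulmx0.
Qed.

Lemma lft0 m1 m2 (a : 'M[K]_m1) b c (d : 'M_m2) : lft a b c d 0 = a.
Proof. by rewrite /lft mulmx0 !mul0mx addr0. Qed.

Lemma lft_fixed m1 m2 (a : 'M[K]_m1) b c (d T : 'M_m2) (x : 'cV_m1) :
  c *m x = 0 -> lft a b c d T *m x = a *m x.
Proof. by move=> cx; rewrite /lft mulmxDl -!mulmxA cx !mulmx0 addr0. Qed.

(** The star product joins the lower output x and lower input y of the first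
    system to the upper input and upper output of the second:

      (v, x) = [a b; c d] (u, y),    (y, w) = [p q; r t] (x, z),

    and sends (u, z) to (v, w).  Its blocks come from solving these equations
    for x, namely x = X (c u + d q z). *)
Section Star.
Variables (m1 m2 m3 : nat).
Variables (a : 'M[K]_m1) (b : 'M[K]_(m1, m2)) (c : 'M[K]_(m2, m1)) (d : 'M[K]_m2).
Variables (p : 'M[K]_m2) (q : 'M[K]_(m2, m3)) (r : 'M[K]_(m3, m2)) (t : 'M[K]_m3).

Let X := invmx (1%:M - d *m p).

Definition star_ul := a + b *m p *m X *m c.
Definition star_ur := b *m (p *m X *m d *m q + q).
Definition star_dl := r *m X *m c.
Definition star_dr := r *m X *m d *m q + t.
Definition star := block_mx star_ul star_ur star_dl star_dr.

Hypothesis U : 1%:M - d *m p \in unitmx.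

(** The star product is characterised by its graph: any solution of the two
    node equations, with its internal signals x and y, computes it. *)
Lemma starP k (u : 'M_(m1, k)) z x y : x = c *m u + d *m y ->
  y = p *m x + q *m z ->
  star *m col_mx u z = col_mx (a *m u + b *m y) (r *m x + t *m z).
Proof.
move=> Ex Ey.
have {}Ex : x = X *m (c *m u + d *m q *m z).
  apply: (canRL (mulKmx U)); rewrite mulmxBl mul1mx {1}Ex Ey.
  by rewrite mulmxDr !mulmxA -addrA addrAC addrN add0r.
rewrite mul_block_col Ey Ex /star_ul /star_ur /star_dl /star_dr.
by congr col_mx; rewrite ?(mulmxDl, mulmxDr) !mulmxA ?addrA.
Qed.

Lemma star_solve k (u : 'M_(m1, k)) z :
  exists x y, x = c *m u + d *m y /\ y = p *m x + q *m z.
Proof.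
have [x Ex] := lft_state (row_mx c (d *m q)) (col_mx u z) U.
exists x, (p *m x + q *m z); split=> //.
by rewrite {1}Ex mul_row_col mulmxDr addrAC -!addrA !mulmxA.
Qed.

(** Closing the second system by T and feeding the result to the first one
    produces signals that solve the node equations with z = T w, so they also
    solve the state equation of the star product closed by T. *)
Lemma lft_star (T : 'M[K]_m3) : 1%:M - t *m T \in unitmx ->
    1%:M - d *m lft p q r t T \in unitmx -> 1%:M - star_dr *m T \in unitmx ->
  lft a b c d (lft p q r t T) = lft star_ul star_ur star_dl star_dr T.
Proof.
move=> UF UG UH.
have [x Ex] := lft_state c (1%:M : 'M_m1) UG.
have [w Ew] := lft_state r x UF.
have Ey := lftE p q UF Ew.
rewrite -[LHS]mulmx1 -[RHS]mulmx1 (lftE _ _ UG Ex).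
have := starP Ex Ey; rewrite mul_block_col => /eq_col_mx[<- Ew'].
by apply/esym/lftE => //; rewrite {1}Ew Ew'.
Qed.

End Star.
End Lft.

(** * Unitary systems closed by a strict contraction *)

Section Unitary.
Variable C : numClosedFieldType.

(** A fixed vector of d T would have to be at most as long as its image under
    T, since d is a compression of a unitary matrix. *)
Lemma unitary_strict_unit m1 m2 (a : 'M[C]_m1) b c (d T : 'M_m2) :
  block_mx a b c d \is unitarymx -> strict_contraction T -> 1%:M - d *m T \in unitmx.
Proof.
move=> U sT; apply/negPn/negP => /non_unit_fixed[w w0 Ew].
have := nsq_block 0 (T *m w) U; rewrite !mulmx0 !add0r (mulmxA d) Ew.
have -> : nsq (0 : 'cV[C]_m1) = 0 by apply/eqP; rewrite nsq_eq0.
by rewrite add0r => E; have /lt_geF/negP := sT w w0; rewrite -E lerDr nsq_ge0.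
Qed.

(** The state w has more energy than T w, and the balance makes the output
    pay for the difference. *)
Lemma lft_contraction m1 m2 (a : 'M[C]_m1) b c (d T : 'M_m2) x :
  block_mx a b c d \is unitarymx -> strict_contraction T ->
  nsq (lft a b c d T *m x) <= nsq x.
Proof.
move=> U sT; have Ud := unitary_strict_unit U sT.
have [w Ew] := lft_state c x Ud.
rewrite (lftE _ _ Ud Ew) -(lerD2r (nsq w)) {2}Ew nsq_block// lerD2l.
exact: strict_le.
Qed.

(** The equality case of the contraction property: no energy is left for the
    state, and a vanishing state means that c kills the input. *)
Lemma lft_isometric m1 m2 (a : 'M[C]_m1) b c (d T : 'M_m2) x :
    block_mx a b c d \is unitarymx -> strict_contraction T ->
  nsq x <= nsq (lft a b c d T *m x) -> c *m x = 0.
Proof.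
move=> U sT; have Ud := unitary_strict_unit U sT.
have [w Ew] := lft_state c x Ud.
rewrite (lftE _ _ Ud Ew) -(lerD2r (nsq w)) {3}Ew nsq_block// lerD2l.
have [w0 _|/sT/lt_geF->//] := eqVneq w 0.
by move: Ew; rewrite w0 !mulmx0 addr0.
Qed.

(** This replaces a maximum principle: a vector fixed by d (lft T') for one
    strict contraction T' is killed by r, so that lft does not depend on its
    last argument at that vector. *)
Lemma unit_lft_indep m1 m2 m3 (a : 'M[C]_m1) b c (d : 'M_m2)
    (p : 'M_m2) q r (t T T' : 'M_m3) :
    block_mx a b c d \is unitarymx -> block_mx p q r t \is unitarymx ->
    strict_contraction T' -> 1%:M - d *m lft p q r t T \in unitmx ->
  1%:M - d *m lft p q r t T' \in unitmx.
Proof.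
move=> UG UF sT'; apply: contraTT => /non_unit_fixed[x x0 Ex].
have rx : r *m x = 0.
  apply: (lft_isometric UF sT'); set y := _ *m x.
  rewrite -{1}Ex -mulmxA -/y.
  have := nsq_block 0 y UG; rewrite !mulmx0 !add0r.
  have -> : nsq (0 : 'cV[C]_m1) = 0 by apply/eqP; rewrite nsq_eq0.
  by rewrite add0r => <-; rewrite lerDr nsq_ge0.
apply: (fixed_non_unit x0).
by rewrite -mulmxA lft_fixed// -[RHS]Ex -[RHS]mulmxA lft_fixed.
Qed.

(** Adding the energy balances of the two nodes cancels the internal signals.
    The inputs are taken to be the two halves of the identity matrix, so that
    the outputs are the star product itself. *)
Lemma star_unitary m1 m2 m3 (a : 'M[C]_m1) b c (d p : 'M_m2) q r (t : 'M_m3) :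
    block_mx a b c d \is unitarymx -> block_mx p q r t \is unitarymx ->
    1%:M - d *m p \in unitmx ->
  star a b c d p q r t \is unitarymx.
Proof.
move=> UG UF U; apply: unitarymx_gram.
have [x [y [Ex Ey]]] := star_solve c q U
  (row_mx 1%:M 0 : 'M[C]_(m1, m1 + m3)) (row_mx 0 1%:M).
have := starP a b r t U Ex Ey.
rewrite -block_mxEv -scalar_mx_block mulmx1 => ->.
rewrite gram_col_mx.
have := gram_block (row_mx 1%:M 0 : 'M[C]_(m1, m1 + m3)) y UG.
have := gram_block x (row_mx 0 1%:M : 'M[C]_(m3, m1 + m3)) UF.
rewrite -Ex -Ey => EF EG; apply: (addIr (gram x + gram y)).
rewrite addrACA EG [gram (r *m _ + _) + _]addrC EF.
rewrite [gram x + gram (row_mx _ _)]addrC addrACA.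
rewrite [gram y + _]addrC; congr (_ + _).
rewrite -gram_col_mx -block_mxEv -scalar_mx_block.
by rewrite /gram trmx1 map_mx1 mulmx1.
Qed.
End Unitary.

(** * Amplification by an identity matrix *)

Section Tensor.
Variable C : numClosedFieldType.

Lemma tensmxDl (K : pzRingType) m n m' n' (A B : 'M[K]_(m, n)) (M : 'M_(m', n')) :
  tensmx (A + B) M = tensmx A M + tensmx B M.
Proof. by apply/matrixP => k l; rewrite !mxE mulrDl. Qed.

Lemma tensmxNl (K : pzRingType) m n m' n' (A : 'M[K]_(m, n)) (M : 'M_(m', n')) :
  tensmx (- A) M = - tensmx A M.
Proof. by apply/matrixP => k l; rewrite !mxE mulNr. Qed.

Lemma tens1mx1 (K : pzRingType) m j :
  tensmx (1%:M : 'M[K]_m) (1%:M : 'M_j) = 1%:M.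
Proof.
apply/matrixP => k l.
case: (mxtens_indexP k) => k1 k2; case: (mxtens_indexP l) => l1 l2.
rewrite tensmxE !mxE -natrM mulnb (can_eq (@mxtens_indexK _ _)).
by rewrite xpair_eqE.
Qed.

Lemma tensmx1M (K : comPzRingType) m n o j (A : 'M[K]_(m, n)) (B : 'M_(n, o)) :
  tensmx (A *m B) (1%:M : 'M_j) = tensmx A 1%:M *m tensmx B 1%:M.
Proof. by rewrite tensmx_mul mulmx1. Qed.

Lemma trmxC_tens1 m n j (A : 'M[C]_(m, n)) :
  (tensmx A (1%:M : 'M_j))^t* = tensmx (A^t*) 1%:M.
Proof. by rewrite trmx_tens map_mxT trmx1 map_mx1. Qed.

Lemma tensmx1_unitary m1 m2 j (a : 'M[C]_m1) b c (d : 'M_m2) :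
    block_mx a b c d \is unitarymx ->
  block_mx (tensmx a 1%:M) (tensmx b 1%:M)
           (tensmx c 1%:M) (tensmx d (1%:M : 'M_j)) \is unitarymx.
Proof.
move=> /unitarymxP; rewrite tr_block_mx map_block_mx mulmx_block scalar_mx_block.
move=> /eq_block_mx[E1 E2 E3 E4].
apply/unitarymxP; rewrite tr_block_mx map_block_mx mulmx_block !trmxC_tens1.
rewrite -!tensmx1M -!tensmxDl E1 E2 E3 E4 !tens0mx !tens1mx1.
by rewrite -scalar_mx_block.
Qed.

Lemma lft_tens (K : fieldType) m1 m2 j (a : 'M[K]_m1) b c (d T : 'M_m2) :
    1%:M - d *m T \in unitmx ->
  lft (tensmx a 1%:M) (tensmx b 1%:M) (tensmx c 1%:M) (tensmx d 1%:M)
      (tensmx T (1%:M : 'M_j)) = tensmx (lft a b c d T) 1%:M.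
Proof.
move=> U; rewrite /lft tensmxDl !tensmx1M; congr (_ + _ *m _ *m _ *m _).
have E : tensmx (1%:M - d *m T) (1%:M : 'M_j) =
         1%:M - tensmx d 1%:M *m tensmx T 1%:M.
  by rewrite tensmxDl tensmxNl tensmx1M tens1mx1.
have V : tensmx (1%:M - d *m T) (1%:M : 'M_j) *m
         tensmx (invmx (1%:M - d *m T)) 1%:M = 1%:M.
  by rewrite -tensmx1M mulmxV// tens1mx1.
by rewrite -E -[LHS]mulmx1 -V mulKmx //; case/mulmx1_unit: V.
Qed.

(** The vector x is an m-by-j array; tensoring T with the identity makes T act
    on each of its j columns separately, which is how strictness is
    inherited. *)
Definition slice m j (k : 'I_j) (x : 'cV[C]_(m * j)) : 'cV[C]_m :=
  \col_l x (mxtens_index (l, k)) ord0.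

Lemma nsq_slice m j (x : 'cV[C]_(m * j)) : nsq x = \sum_k nsq (slice k x).
Proof.
rewrite exchange_big pair_big /=.
rewrite /nsq (reindex (@mxtens_index m j)) /=; last first.
  by exists (@mxtens_unindex m j) => k _; rewrite (mxtens_indexK, mxtens_unindexK).
by apply: eq_bigr => -[l k] _; rewrite mxE.
Qed.

Lemma slice_tens m j (T : 'M[C]_m) (k : 'I_j) (x : 'cV_(m * j)) :
  slice k (tensmx T 1%:M *m x) = T *m slice k x.
Proof.
apply/matrixP => l u; rewrite !mxE.
rewrite (reindex (@mxtens_index m j)) /=; last first.
  by exists (@mxtens_unindex m j) => h _; rewrite (mxtens_indexK, mxtens_unindexK).
transitivity (\sum_l' \sum_k' tensmx T (1%:M : 'M_j)
   (mxtens_index (l, k)) (mxtens_index (l', k')) * x (mxtens_index (l', k')) ord0).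
  by rewrite pair_big; apply: eq_bigr => -[].
apply: eq_bigr => l' _; rewrite (bigD1 k)//= tensmxE !mxE eqxx mulr1.
rewrite big1 ?addr0// => k' kk'.
by rewrite tensmxE !mxE eq_sym (negPf kk') mulr0 mul0r.
Qed.

Lemma strict_tens m j (T : 'M[C]_m) : strict_contraction T -> strict_contraction (tensmx T (1%:M : 'M_j)).
Proof.
move=> sT x x0; rewrite !nsq_slice.
have [k xk] : exists k, slice k x != 0.
  apply/existsP; rewrite -negb_forall; apply: contra x0 => /forallP xs0.
  by rewrite -nsq_eq0 nsq_slice big1// => k _; apply/eqP; rewrite nsq_eq0.
rewrite (bigD1 k)//= [ltRHS](bigD1 k)//= slice_tens ltr_leD ?sT//.
by apply: ler_sum => k' _; rewrite slice_tens strict_le.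
Qed.

(** The two sides live in matrix spaces whose sizes are equal only up to
    associativity of the product, hence the cast. *)
Lemma tensmx11 (K : pzRingType) m i j (S : 'M[K]_m) :
  tensmx (tensmx S (1%:M : 'M_i)) (1%:M : 'M_j) =
  castmx (mulnA m i j, mulnA m i j) (tensmx S 1%:M).
Proof.
have E (l : 'I_m) (k : 'I_i) (h : 'I_j) :
    mxtens_index (mxtens_index (l, k), h) =
    cast_ord (mulnA m i j) (mxtens_index (l, mxtens_index (k, h))).
  by apply: val_inj => /=; rewrite mulnA mulnDl addnA.
apply/matrixP => k l.
case: (mxtens_indexP k) => k12 k3; case: (mxtens_indexP k12) => k1 k2.
case: (mxtens_indexP l) => l12 l3; case: (mxtens_indexP l12) => l1 l2.
rewrite castmxE !tensmxE !E !cast_ordK tensmxE -mulrA; congr (_ * _).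
by rewrite -tensmxE tens1mx1.
Qed.

(** Transports the cast from the argument to the coefficients. *)
Lemma lft_cast m1 m2 m2' (e : m2 = m2') (a : 'M[C]_m1) b c
    (d : 'M_m2') : block_mx a b c d \is unitarymx ->
  exists b' c' (d' : 'M_m2), block_mx a b' c' d' \is unitarymx /\
    forall T, lft a b c d (castmx (e, e) T) = lft a b' c' d' T.
Proof.
case: m2' / e in b c d * => U; by exists b, c, d.
Qed.
End Tensor.

(** * From the operator norm to strict contractions *)

Section OpNorm.
Variable R : realType.
Local Notation C := R[i].

Lemma normC_normc (z : C) : `|z| = (ComplexField.Normc.normc z)%:C.
Proof. by case: z. Qed.

Lemma euclid_normE n (x : 'cV[C]_n) : (euclid_norm x ^+ 2)%:C = nsq x.
Proof.
rewrite sqr_sqrtr ?sumr_ge0// => [|k _]; last exact: sqr_ge0.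
rewrite rmorph_sum; apply: eq_bigr => k _.
by rewrite normC_normc rmorphXn.
Qed.

Lemma euclid_norm_ge0 n (x : 'cV[C]_n) : 0 <= euclid_norm x.
Proof. exact: sqrtr_ge0. Qed.

Lemma le_nsq n m (x : 'cV[C]_n) (y : 'cV[C]_m) :
  (nsq x <= nsq y) = (euclid_norm x <= euclid_norm y).
Proof.
by rewrite -!euclid_normE lecR ler_pXn2r// nnegrE euclid_norm_ge0.
Qed.

Lemma lt_nsq n m (x : 'cV[C]_n) (y : 'cV[C]_m) :
  (nsq x < nsq y) = (euclid_norm x < euclid_norm y).
Proof.
by rewrite -!euclid_normE ltcR ltr_pXn2r// nnegrE euclid_norm_ge0.
Qed.

Lemma euclid_norm_eq0 n (x : 'cV[C]_n) : (euclid_norm x == 0) = (x == 0).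
Proof. by rewrite -nsq_eq0 -euclid_normE eq_complex /= eqxx andbT sqrf_eq0. Qed.

Lemma euclid_normZ n (s : R) (x : 'cV[C]_n) : 0 <= s ->
  euclid_norm (s%:C *: x) = s * euclid_norm x.
Proof.
move=> s0; apply/eqP; rewrite -(@eqrXn2 _ 2)// ?mulr_ge0 ?euclid_norm_ge0//.
apply/eqP/complexI; transitivity (nsq (s%:C *: x)); first by rewrite euclid_normE.
rewrite nsqZ -euclid_normE ger0_norm ?lecR// !expr2.
by simpc; rewrite mulrACA.
Qed.

Lemma op_norm_le1 n (z : 'M[C]_n) :
  (forall x : 'cV_n, nsq (z *m x) <= nsq x) -> op_norm z <= 1.
Proof.
move=> zP; apply: ge_sup; last first.
  by move=> _ [x /= x1 <-]; apply: le_trans x1; rewrite -le_nsq.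
exists (euclid_norm (z *m 0)), 0 => //=.
have /eqP -> : euclid_norm (0 : 'cV[C]_n) == 0 by rewrite euclid_norm_eq0.
exact: ler01.
Qed.

(** The operator norm is defined as a supremum, which is an upper bound only
    for a bounded set; the vector of the row sums of |z| gives a crude
    bound. *)
Lemma op_norm_bounded n (z : 'M[C]_n) :
  has_ubound [set euclid_norm (z *m x) | x in [set x : 'cV_n | euclid_norm x <= 1]].
Proof.
exists (euclid_norm (\col_k \sum_l `|z k l|)) => _ [x /= x1 <-].
rewrite -le_nsq; apply: ler_sum => k _.
rewrite ler_pXn2r// ?nnegrE// !mxE [leRHS]ger0_norm ?sumr_ge0//.
apply: le_trans (ler_norm_sum _ _ _) _; apply: ler_sum => l _.
rewrite normrM ler_piMr// -(@ler_pXn2r _ 2)// ?nnegrE//.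
rewrite expr1n; apply: (@le_trans _ _ (nsq x)).
  by rewrite /nsq (bigD1 l)//= lerDl sumr_ge0// => h _; rewrite exprn_ge0.
by rewrite -euclid_normE lecR expr_le1// euclid_norm_ge0.
Qed.

Lemma mxball_strict n (z : 'M[C]_n) : mxball z -> strict_contraction z.
Proof.
move=> z1 x x0; rewrite lt_nsq.
have x_gt0 : 0 < euclid_norm x by rewrite lt_def euclid_norm_eq0 x0 euclid_norm_ge0.
(* Rescaling x to a unit vector makes it a competitor in the supremum. *)
rewrite -(@ltr_pM2l _ (euclid_norm x)^-1) ?invr_gt0// mulVf ?gt_eqF//.
rewrite -euclid_normZ ?invr_ge0 ?euclid_norm_ge0// scalemxAr.
apply: le_lt_trans z1; apply: ub_le_sup; first exact: op_norm_bounded.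
exists ((euclid_norm x)^-1%:C *: x) => //.
by rewrite /= euclid_normZ ?invr_ge0 ?euclid_norm_ge0// mulVf ?gt_eqF.
Qed.

Lemma char_formulaE m n j (a : 'M[C]_n) b c (d : 'M_(m * j)) S :
  char_formula (block_mx a b c d) S = lft a b c d (tensmx S (1%:M : 'M_j)).
Proof.
by rewrite /char_formula /char_den block_mxKul block_mxKur block_mxKdl block_mxKdr.
Qed.

Lemma charfun_unit m n j (a : 'M[C]_n) b c (d : 'M_(m * j)) S :
    op_norm S <= 1 -> 1%:M - d *m tensmx S (1%:M : 'M_j) \in unitmx ->
  charfun (block_mx a b c d) S = Some (lft a b c d (tensmx S (1%:M : 'M_j))).
Proof.
rewrite unitmxE unitfE => S1 U.
by rewrite /charfun S1 /char_den block_mxKdr U char_formulaE.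
Qed.
End OpNorm.

(** * Composition of characteristic functions *)

Theorem theorem1p5 (R : realType) (alpha beta gamma : nat)
  (alpha_gt0 : (0 < alpha)%N) (beta_gt0 : (0 < beta)%N) (gamma_gt0 : (0 < gamma)%N)
  (i j : nat)
  (a : 'M[R[i]]_gamma) (b : 'M[R[i]]_(gamma, beta * j))
  (c : 'M[R[i]]_(beta * j, gamma)) (d : 'M[R[i]]_(beta * j))
  (p : 'M[R[i]]_beta) (q : 'M[R[i]]_(beta, alpha * i))
  (r : 'M[R[i]]_(alpha * i, beta)) (t : 'M[R[i]]_(alpha * i))
  (G_unitary : block_mx a b c d \is unitarymx)
  (F_unitary : block_mx p q r t \is unitarymx) :
  (\det (1%:M - d *m ampl j p) != 0 ->
     @Char R alpha gamma (pcomp (charfun (block_mx a b c d)) (charfun (block_mx p q r t))))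
  /\
  ((exists2 S0 : 'M[R[i]]_alpha, mxball S0 &
      \det (1%:M - d *m ampl j (char_formula (block_mx p q r t) S0)) != 0) ->
     @Char R alpha gamma (pcomp (charfun (block_mx a b c d)) (charfun (block_mx p q r t)))).
Proof.
pose P := tensmx p (1%:M : 'M_j); pose Q := tensmx q (1%:M : 'M_j).
pose R' := tensmx r (1%:M : 'M_j); pose T := tensmx t (1%:M : 'M_j).
pose Z (S : 'M[R[i]]_alpha) := tensmx (tensmx S (1%:M : 'M_i)) (1%:M : 'M_j).
have sS (S : 'M[R[i]]_alpha) : mxball S -> strict_contraction (tensmx S (1%:M : 'M_i)).
  by move=> /mxball_strict; apply: strict_tens.
have UF : block_mx P Q R' T \is unitarymx := tensmx1_unitary j F_unitary.
have FS (S : 'M[R[i]]_alpha) : mxball S ->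
    ampl j (char_formula (block_mx p q r t) S) = lft P Q R' T (Z S).
  move=> S1; rewrite /ampl char_formulaE; apply/esym/lft_tens.
  exact: unitary_strict_unit F_unitary (sS S S1).
(* Both hypotheses reduce to the one at p: for the second, F(0) = p and the
   zero matrix is a strict contraction. *)
suff main : 1%:M - d *m P \in unitmx -> Char (pcomp (charfun (block_mx a b c d))
    (charfun (block_mx p q r t)) : 'M_alpha -> option 'M_gamma).
  split=> [dp|[S0 S01]].
    by apply: main; rewrite unitmxE unitfE.
  rewrite (FS S0 S01) => dF; apply: main.
  have US0 : 1%:M - d *m lft P Q R' T (Z S0) \in unitmx by rewrite unitmxE unitfE.
  have := unit_lft_indep G_unitary UF (@strict0 _ _) US0.
  by rewrite lft0.
move=> U.
have [b' [c' [d' [UH EH]]]] := lft_cast (mulnA alpha i j)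
  (star_unitary G_unitary UF U).
exists (i * j)%N, (block_mx (star_ul a b c d P) b' c' d'); split=> // S S1.
have sZ : strict_contraction (Z S) by apply/strict_tens/sS.
have UFS : 1%:M - t *m tensmx S (1%:M : 'M_i) \in unitmx.
  exact: unitary_strict_unit F_unitary (sS S S1).
have UGF : 1%:M - d *m lft P Q R' T (Z S) \in unitmx.
  have U0 : 1%:M - d *m lft P Q R' T 0 \in unitmx by rewrite lft0.
  exact: unit_lft_indep G_unitary UF sZ U0.
have UFZ := unitary_strict_unit UF sZ.
have UHZ := unitary_strict_unit (star_unitary G_unitary UF U) sZ.
have FS1 : op_norm (char_formula (block_mx p q r t) S) <= 1.
  apply: op_norm_le1 => x; rewrite char_formulaE.
  exact: lft_contraction F_unitary (sS S S1).
have UH' := unitary_strict_unit UH (strict_tens (mxball_strict S1)).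
rewrite (charfun_unit _ b' c' (ltW S1) UH') /pcomp.
rewrite (charfun_unit p q r (ltW S1) UFS) /= -char_formulaE.
have UGS : 1%:M - d *m tensmx (char_formula (block_mx p q r t) S) (1%:M : 'M_j)
    \in unitmx by move: UGF; rewrite -(FS S S1).
rewrite (charfun_unit a b c FS1 UGS); congr Some.
transitivity (lft a b c d (lft P Q R' T (Z S))); first by rewrite -(FS S S1).
by rewrite (lft_star a b c U UFZ UGF UHZ) /Z tensmx11 EH.
Qed.
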